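(* (i) $\mathcal{A}(r,n)^{\mathbf T}=\mathcal{A}(r,n)^{\mathbf T_{r+2}}$. (ii) A fixed point $\alpha_\mu\in\mathcal{A}(r,n)^{\mathbf T}$ belongs to $\mathcal{Q}(r,n)^{\mathbf T}$ (viewed inside $\mathcal{A}(r,n)$ via $\imath$) if and only if the $r$-partition $\mu$ is nested, i.e. $\mu_r\subseteq\mu_{r-1}\subseteq\cdots\subseteq\mu_1$ as Young diagrams. Hence $\mathcal{Q}(r,n)^{\mathbf T}$ is finite and in bijection with nested $r$-partitions of $n$. (iii) The closed embedding $\mathcal{Q}_0(r,n)\hookrightarrow\mathcal{Q}(r,n)$ induces an isomorphism of $\mathbf T$-fixed loci. Hence $\mathcal{Q}_0(r,n)^{\mathbf T}$ is also finite and in bijection with nested $r$-partitions of $n$.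
   Context: **Moduli spaces.** $\mathcal{A}(r,n)$ is the moduli space of stable ADHM data $(V,B_1,B_2,I,J)$ with $\dim V=n$, $V_\infty=\mathbb{C}^r$ (basis $e_a$), $[B_1,B_2]+IJ=0$, and no proper $B_1,B_2$-invariant subspace containing $\mathrm{Im}\,I$. It is identified with the moduli space of rank $r$ framed torsion-free sheaves on $\mathbb{P}^2$ with $c_2=n$. $\mathcal{Q}(r,n)$ is the moduli space of framed cyclic representations $(V,B_1,B_2,B_3,I,J)$. These satisfy $[B_1,B_2]+IJ=0$, $JB_3=A_rJ$, $B_3I=IA_r$ and $[B_3,B_1]=[B_3,B_2]=0$, where $A_re_a=e_{a+1}$ and $e_{r+1}=0$, and no proper nonzero $B_1,B_2,B_3$-invariant subspace contains $\mathrm{Im}\,I$. The closed embedding $\imath:\mathcal{Q}(r,n)\to\mathcal{A}(r,n)$ forgets $B_3$. $\mathcal{Q}_0(r,n)\subset\mathcal{Q}(r,n)$ is the closed subscheme where $J=0$. **Torus actions.** $\mathbf{T}_{r+2}=(\mathbb{C}^\times)^2\times(\mathbb{C}^\times)^r$ acts on $\mathcal{A}(r,n)$ by $(t_1,t_2,u)\cdot(B_1,B_2,I,J)=(t_1B_1,t_2B_2,Iu^{-1},t_1t_2uJ)$, where $u=\mathrm{diag}(u_1,\dots,u_r)$. Its fixed points $\alpha_\mu$ are finitely many and indexed by $r$-partitions $\mu=(\mu_1,\dots,\mu_r)$ of $n$. The point $\alpha_\mu$ corresponds to the framed sheaf $\bigoplus_aI_{Z_{\mu_a}}$, where $I_{Z_{\mu_a}}$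 is the monomial ideal of $\mu_a$ in $\mathbb{A}^2=\mathbb{P}^2\setminus\{z_0=0\}$. $\mathbf{T}=(\mathbb{C}^\times)^3$ embeds in $\mathbf{T}_{r+2}$ by $(t_1,t_2,t_3)\mapsto(t_1,t_2,(t_3^{1-a})_{1\leq a\leq r})$. Writing $I_a=I(e_a)$ and $J_a$ for the components of $J$, $\mathbf{T}$ acts on $\mathcal{Q}(r,n)$ by $(t_i)\cdot(B_i,I_a,J_a)=(t_iB_i,\,t_3^{a-1}I_a,\,t_1t_2t_3^{1-a}J_a)$ for $1\leq i\leq3$. On $\mathcal{A}(r,n)$ it acts by the same formula with $B_3$ omitted. *)

(* Defs.v *)
From HB Require Import structures.
From mathcomp Require Import all_boot all_order all_algebra.
Set Implicit Arguments. Unset Strict Implicit. Unset Printing Implicit Defensive.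
Import Order.TTheory GRing.Theory Num.Theory.
Local Open Scope ring_scope.

(* Conventions: V = F^n is realised as row vectors 'rV[F]_n, V_oo = F^r as
   'rV[F]_r, and a linear map X -> Y is a matrix acting on the RIGHT
   (v |-> v *m M).  Hence the operator composition X o Y is the matrix
   product Y *m X.  Row a of I is I(e_a) (0-based index a <-> e_{a+1}),
   column a of J is the component J_a. *)

Section ADHM.
Variables (F : closedFieldType) (r n : nat).

Record adhm := ADHM {
  aB1 : 'M[F]_n; aB2 : 'M[F]_n; aI : 'M[F]_(r, n); aJ : 'M[F]_(n, r) }.

Record cyc := CYC {
  cB1 : 'M[F]_n; cB2 : 'M[F]_n; cB3 : 'M[F]_n;
  cI : 'M[F]_(r, n); cJ : 'M[F]_(n, r) }.

(* A_r e_a = e_{a+1}, e_{r+1} = 0 *)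
Definition shiftA : 'M[F]_r := \matrix_(i, j) ((j == i.+1 :> nat)%:R).

(* [B1,B2] + IJ = 0 *)
Definition adhm_eq (B1 B2 : 'M[F]_n) (I : 'M[F]_(r, n)) (J : 'M[F]_(n, r)) :=
  B2 *m B1 - B1 *m B2 + J *m I = 0.

Definition A_stable (x : adhm) :=
  forall S : 'M[F]_n, (aI x <= S)%MS -> stablemx S (aB1 x) ->
    stablemx S (aB2 x) -> row_full S.

Definition A_point (x : adhm) :=
  adhm_eq (aB1 x) (aB2 x) (aI x) (aJ x) /\ A_stable x.

Definition Q_stable (y : cyc) :=
  forall S : 'M[F]_n, (cI y <= S)%MS -> stablemx S (cB1 y) ->
    stablemx S (cB2 y) -> stablemx S (cB3 y) -> row_full S.

Definition Q_point (y : cyc) :=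
  adhm_eq (cB1 y) (cB2 y) (cI y) (cJ y) /\
  [/\
      cB3 y *m cJ y = cJ y *m shiftA,
      cI y *m cB3 y = shiftA *m cI y,
      cB1 y *m cB3 y = cB3 y *m cB1 y,
      cB2 y *m cB3 y = cB3 y *m cB2 y
    & Q_stable y].

Definition Q0_point (y : cyc) := Q_point y /\ cJ y = 0.

Definition forget (y : cyc) : adhm := ADHM (cB1 y) (cB2 y) (cI y) (cJ y).

(* points of the moduli spaces = GL(V)-orbits *)
Definition isoA (x x' : adhm) :=
  exists2 g : 'M[F]_n, g \in unitmx &
    [/\ aB1 x' = invmx g *m aB1 x *m g, aB2 x' = invmx g *m aB2 x *m g,
        aI x' = aI x *m g & aJ x' = invmx g *m aJ x].

Definition isoQ (y y' : cyc) :=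
  exists2 g : 'M[F]_n, g \in unitmx &
    [/\ cB1 y' = invmx g *m cB1 y *m g, cB2 y' = invmx g *m cB2 y *m g,
        cB3 y' = invmx g *m cB3 y *m g,
        cI y' = cI y *m g & cJ y' = invmx g *m cJ y].

Definition actA (t1 t2 : F) (u : 'I_r -> F) (x : adhm) : adhm :=
  ADHM (t1 *: aB1 x) (t2 *: aB2 x)
       (\matrix_(a, k) ((u a)^-1 * aI x a k))
       (\matrix_(k, a) (t1 * t2 * u a * aJ x k a)).

(* T = (C^x)^3 embedded by u_a = t3^(1-a)  (0-based index a : u = t3^-a) *)
Definition Tu (t3 : F) : 'I_r -> F := fun a => t3 ^- a.

Definition actQ (t1 t2 t3 : F) (y : cyc) : cyc :=
  CYC (t1 *: cB1 y) (t2 *: cB2 y) (t3 *: cB3 y)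
      (\matrix_(a, k) (t3 ^+ a * cI y a k))
      (\matrix_(k, a) (t1 * t2 * t3 ^- a * cJ y k a)).

Definition fixedA_T (x : adhm) :=
  forall t1 t2 t3 : F, t1 != 0 -> t2 != 0 -> t3 != 0 ->
    isoA (actA t1 t2 (Tu t3) x) x.

Definition fixedA_Tr2 (x : adhm) :=
  forall (t1 t2 : F) (u : 'I_r -> F), t1 != 0 -> t2 != 0 ->
    (forall a, u a != 0) -> isoA (actA t1 t2 u x) x.

Definition fixedQ_T (y : cyc) :=
  forall t1 t2 t3 : F, t1 != 0 -> t2 != 0 -> t3 != 0 ->
    isoQ (actQ t1 t2 t3 y) y.

End ADHM.

(* Partitions / Young diagrams: a partition is a nonincreasing list of
   positive parts; row i of the diagram has length (nth 0 p i). *)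
Definition is_partition (p : seq nat) :=
  sorted geq p && all (fun k => 0 < k)%N p.

Definition rpartition (r n : nat) (m : r.-tuple (seq nat)) :=
  all is_partition m /\ (\sum_(a < r) sumn (tnth m a))%N = n.

Definition subdiagram (p q : seq nat) := forall i, (nth 0 p i <= nth 0 q i)%N.

Definition nested (r : nat) (m : r.-tuple (seq nat)) :=
  forall (a : 'I_r) (h : (a.+1 < r)%N), subdiagram (tnth m (Ordinal h)) (tnth m a).

(* boxes (i,j) of a diagram, i = row, j < length of row i;
   the box (i,j) corresponds to the monomial x^i y^j of C[x,y]/I_Z *)
Definition boxes (p : seq nat) : seq (nat * nat) :=
  flatten [seq [seq (i, j) | j <- iota 0 (nth 0 p i)] | i <- iota 0 (size p)].

Definition rboxes (r : nat) (m : r.-tuple (seq nat)) : seq (nat * (nat * nat)) :=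
  flatten [seq [seq (val a, b) | b <- boxes (tnth m a)] | a <- enum 'I_r].

(* The fixed point alpha_mu: V = (+)_a C[x,y]/I_{Z_{mu_a}} with the monomial
   basis indexed by rboxes, B1 / B2 multiplication by x / y, I(e_a) = 1 in the
   a-th summand, J = 0. *)
Definition alpha (F : closedFieldType) (r n : nat) (m : r.-tuple (seq nat))
  : adhm F r n :=
  let L := rboxes m in
  let idx (k : 'I_n) := nth (0%N, (0%N, 0%N)) L k in
  ADHM
    (\matrix_(k, l) ((idx l == ((idx k).1, ((idx k).2.1.+1, (idx k).2.2)))%:R))
    (\matrix_(k, l) ((idx l == ((idx k).1, ((idx k).2.1, (idx k).2.2.+1)))%:R))
    (\matrix_(a, l) ((idx l == (val a, (0%N, 0%N)))%:R))
    0.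

(* Main.v *)
(* Let [g] realise a torus element [(t1, t2, t3)] at a [T]-fixed datum
   [(B1, B2, I, J)]: [g B1 = t1 B1 g], [g B2 = t2 B2 g], [I(e_a) g = t3^-a I(e_a)]
   and [g J = J diag(t1 t2 t3^-a)].  A word in [B1, B2] with [i] letters [B1] and
   [j] letters [B2], applied to [I(e_a)], is then an eigenvector of [g] for the
   eigenvalue [1 / (t3^a t1^i t2^j)], and by stability such vectors span [V].
   For [(t1, t2, t3) = (2, 3, 5)] in characteristic 0 these eigenvalues are
   pairwise distinct and differ from the weights [t1 t2 t3^-a] of [J], so [J = 0].
   Hence [B1] and [B2] commute, and the nonzero [I(e_a) B1^i B2^j] form an
   eigenbasis of [V] indexed by the boxes of an [r]-partition [mu]: the datum is
   [alpha_mu], which diagonal matrices show to be fixed by all of [T_{r+2}].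
   On [Q(r, n)], [B3] maps [I(e_a) B1^i B2^j] to [I(e_{a+1}) B1^i B2^j], which
   forces [mu] to be nested; conversely, for nested [mu] this shift of boxes
   defines [B3] on [alpha_mu]. *)

Require Import Defs.
From HB Require Import structures.
From mathcomp Require Import all_boot all_order all_algebra.
From mathcomp Require Import ring.
Set Implicit Arguments. Unset Strict Implicit. Unset Printing Implicit Defensive.
Import Order.TTheory GRing.Theory Num.Theory.

Notation box := (nat * (nat * nat))%type.
Notation box0 := ((0, (0, 0)) : box).

Lemma mem_boxes p i j : ((i, j) \in boxes p) = (j < nth 0 p i).
Proof.
apply/flatten_mapP/idP => [[i' _ /mapP [j' + [-> ->]]]|jp]; first by rewrite mem_iota.
have ip : i < size p by rewrite ltnNge; apply: contraTN jp => /(nth_default 0) ->.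
by exists i; rewrite ?mem_iota //; apply/mapP; exists j; rewrite ?mem_iota.
Qed.

Lemma uniq_boxes p : uniq (boxes p).
Proof.
apply: allpairs_uniq_dep => [|i _|[i j] [i' j'] _ _ /= [-> ->]] //; exact: iota_uniq.
Qed.

Lemma size_boxes p : size (boxes p) = sumn p.
Proof.
rewrite size_allpairs_dep (eq_map (fun i => size_iota 0 (nth 0 p i))).
by rewrite -/(mkseq _ _) mkseq_nth.
Qed.

Lemma mem_rboxes r (mu : r.-tuple (seq nat)) a i j :
  ((a, (i, j)) \in rboxes mu) = (a < r) && (j < nth 0 (nth [::] mu a) i).
Proof.
apply/flatten_mapP/idP => [[b _ /mapP [[i' j'] + [-> -> ->]]]|/andP [ar jp]].
  by rewrite ltn_ord -(tnth_nth [::]) -mem_boxes.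
exists (Ordinal ar); first by rewrite mem_enum.
by apply/mapP; exists (i, j); rewrite // mem_boxes (tnth_nth [::]).
Qed.

Lemma rboxes_lt r (mu : r.-tuple (seq nat)) (t : box) : t \in rboxes mu -> t.1 < r.
Proof. by case: t => a [i j]; rewrite mem_rboxes => /andP []. Qed.

Lemma uniq_rboxes r (mu : r.-tuple (seq nat)) : uniq (rboxes mu).
Proof.
apply: allpairs_uniq_dep => [|a _|[a t] [a' t'] _ _ /= [/val_inj -> ->]] //.
  exact: enum_uniq.
exact: uniq_boxes.
Qed.

Lemma size_rboxes r (mu : r.-tuple (seq nat)) :
  size (rboxes mu) = \sum_(a < r) sumn (tnth mu a).
Proof.
rewrite size_allpairs_dep sumnE big_map big_enum /=.
by apply: eq_bigr => a _; rewrite size_boxes.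
Qed.

Lemma partition_nthS p i : is_partition p -> nth 0 p i.+1 <= nth 0 p i.
Proof.
case/andP => /(sortedP 0) sorted_p _.
by case: (ltnP i.+1 (size p)) => [/sorted_p //|ip]; rewrite nth_default.
Qed.

Lemma partition_nth_gt0 p i : is_partition p -> (0 < nth 0 p i) = (i < size p).
Proof.
case/andP => _ /allP pos_p.
by case: (ltnP i (size p)) => ip; [rewrite pos_p ?mem_nth | rewrite nth_default].
Qed.

Lemma ltn_ext m1 m2 : (forall j, (j < m1) = (j < m2)) -> m1 = m2.
Proof. by move=> h; apply/anti_leq; rewrite leqNgt h ltnn leqNgt -h ltnn. Qed.

Lemma eq_partition_boxes p q : is_partition p -> is_partition q ->
  boxes p =i boxes q -> p = q.
Proof.
move=> pp pq e.
have nth_pq i : nth 0 p i = nth 0 q i by apply: ltn_ext => j; rewrite -!mem_boxes e.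
have size_pq : size p = size q.
  by apply: ltn_ext => i; rewrite -(partition_nth_gt0 _ pp) -(partition_nth_gt0 _ pq) nth_pq.
exact: eq_from_nth size_pq (fun i _ => nth_pq i).
Qed.

Lemma eq_rpartition_rboxes r n (mu nu : r.-tuple (seq nat)) :
  rpartition n mu -> rpartition n nu -> rboxes mu =i rboxes nu -> mu = nu.
Proof.
case=> /allP mu_part _ [/allP nu_part _] e; apply: eq_from_tnth => a.
apply: eq_partition_boxes; [exact/mu_part/mem_tnth | exact/nu_part/mem_tnth |].
case=> i j; have := e (val a, (i, j)).
by rewrite !mem_rboxes ltn_ord -!(tnth_nth [::]) -!mem_boxes.
Qed.

Section DownClosed.
Variables (Q : pred nat) (N : nat).
Hypotheses (Q_down : forall j, Q j.+1 -> Q j) (Q_bounded : forall j, Q j -> j < N).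

Lemma down_closed_count j : Q j = (j < count Q (iota 0 N)).
Proof.
have Q_le k l : Q k -> l <= k -> Q l.
  elim: k => [|k IH] Qk; first by rewrite leqn0 => /eqP ->.
  by rewrite leq_eqVlt => /orP [/eqP -> // | /IH]; apply; apply: Q_down.
have [Qj | nQj] := boolP (Q j).
  rewrite -(subnKC (Q_bounded Qj)) iotaD count_cat.
  suff -> : count Q (iota 0 j.+1) = j.+1 by rewrite leq_addr.
  rewrite (eq_in_count (a2 := predT)) ?count_predT ?size_iota // => l.
  by rewrite mem_iota => /andP [_ lj]; apply: Q_le Qj _.
apply/esym/negbTE; rewrite -leqNgt.
case: (ltnP j N) => jN; last by rewrite (leq_trans (count_size _ _)) ?size_iota.
rewrite -(subnKC (ltnW jN)) iotaD count_cat.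
have -> : count Q (iota (0 + j) (N - j)) = 0.
  apply/eqP; rewrite -leqn0 leqNgt -has_count; apply/hasP => [[l]].
  by rewrite mem_iota add0n => /andP [jl _] Ql; move: (Q_le _ _ Ql jl); rewrite (negbTE nQj).
by rewrite addn0 (leq_trans (count_size _ _)) // size_iota.
Qed.

End DownClosed.

Section DiagramOf.
Variables (P : nat -> nat -> bool) (N : nat).
Hypotheses (P_downS1 : forall i j, P i.+1 j -> P i j)
  (P_downS2 : forall i j, P i j.+1 -> P i j)
  (P_bounded : forall i j, P i j -> (i < N) && (j < N)).

Definition diagram_of : seq nat :=
  mkseq (fun i => count (P i) (iota 0 N)) (count (P^~ 0) (iota 0 N)).

Let row_count i j : P i j = (j < count (P i) (iota 0 N)).
Proof. by apply: down_closed_count => [k|k /P_bounded /andP []]; [exact: P_downS2|]. Qed.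

Let col_count i : P i 0 = (i < count (P^~ 0) (iota 0 N)).
Proof.
by apply: (down_closed_count (Q := P^~ 0)) => [k|k /P_bounded /andP []]; [exact: P_downS1|].
Qed.

Lemma nth_diagram_of i : nth 0 diagram_of i = count (P i) (iota 0 N).
Proof.
case: (ltnP i (count (P^~ 0) (iota 0 N))) => h; first by rewrite nth_mkseq.
rewrite nth_default ?size_mkseq //; apply/esym/eqP.
by rewrite -leqn0 leqNgt -row_count col_count ltnNge h.
Qed.

Lemma mem_diagram_of i j : P i j = (j < nth 0 diagram_of i).
Proof. by rewrite nth_diagram_of row_count. Qed.

Lemma diagram_of_partition : is_partition diagram_of.
Proof.
apply/andP; split.
  apply/(sortedP 0) => i; rewrite size_mkseq => _; rewrite !nth_diagram_of /=.
  case e: (count (P i.+1) (iota 0 N)) => [//|c].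
  by rewrite -row_count; apply: P_downS1; rewrite row_count e.
apply/allP => c /mapP [i]; rewrite mem_iota add0n => /andP [_ h] ->.
by rewrite -row_count col_count.
Qed.

End DiagramOf.

Local Open Scope ring_scope.

Section MatrixFacts.
Variable F : fieldType.

Lemma invmx_conjP n (g A B : 'M[F]_n) : g \in unitmx ->
  A = invmx g *m B *m g <-> g *m A = B *m g.
Proof.
move=> gu; split=> [->|gA]; first by rewrite !mulmxA mulmxV // mul1mx.
by rewrite -mulmxA -gA mulmxA mulVmx // mul1mx.
Qed.

Lemma invmx_mulP m n (g : 'M[F]_n) (J J' : 'M[F]_(n, m)) : g \in unitmx ->
  J' = invmx g *m J <-> g *m J' = J.
Proof. by move=> gu; split=> [->|<-]; rewrite ?mulKVmx ?mulKmx. Qed.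

Lemma row_diag_mul m p (d : 'rV[F]_m) (A : 'M[F]_(m, p)) i :
  row i (diag_mx d *m A) = d 0 i *: row i A.
Proof. by rewrite row_mul row_diag_mx -scalemxAl -rowE. Qed.

Lemma intertwineX n (g B B' : 'M[F]_n) k : g *m B' = B *m g -> g *m B' ^+ k = B ^+ k *m g.
Proof.
move=> e; elim: k => [|k IH]; first by rewrite !expr0 mulmx1 mul1mx.
by rewrite !exprSr -!mulmxE mulmxA IH -!mulmxA e.
Qed.

Lemma diag_mx_unit m (d : 'rV[F]_m) : (forall i, d 0 i != 0) -> diag_mx d \in unitmx.
Proof. by move=> d_nz; rewrite unitmxE det_diag unitfE; apply/prodf_neq0. Qed.

Definition nrow m n (A : 'M[F]_(m, n)) (a : nat) : 'rV[F]_n :=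
  oapp (fun i : 'I_m => row i A) 0 (insub a).

Lemma nrowE m n (A : 'M[F]_(m, n)) (a : 'I_m) : nrow A a = row a A.
Proof. by rewrite /nrow valK. Qed.

Lemma nrow_out m n (A : 'M[F]_(m, n)) a : (m <= a)%N -> nrow A a = 0.
Proof. by move=> ma; rewrite /nrow insubN // -leqNgt. Qed.

Lemma nrowMr m n p (A : 'M[F]_(m, n)) (M : 'M[F]_(n, p)) a :
  nrow (A *m M) a = nrow A a *m M.
Proof.
case: (ltnP a m) => [am|ma]; last by rewrite !nrow_out ?mul0mx.
by rewrite -[a]/(val (Ordinal am)) !nrowE row_mul.
Qed.

Lemma nrow_sub m n (A : 'M[F]_(m, n)) a : (nrow A a <= A)%MS.
Proof.
case: (ltnP a m) => [am|ma]; last by rewrite nrow_out ?sub0mx.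
by rewrite -[a]/(val (Ordinal am)) nrowE row_sub.
Qed.

End MatrixFacts.

Lemma nrow_shiftA (F : closedFieldType) r n (I : 'M[F]_(r, n)) a :
  nrow (shiftA F r *m I) a = nrow I a.+1.
Proof.
case: (ltnP a r) => [ar|ra]; last by rewrite !nrow_out // ltnW.
rewrite -[a]/(val (Ordinal ar)) nrowE row_mul /=; apply/rowP => k.
rewrite !mxE; case: (ltnP a.+1 r) => [a1r|ra1].
  rewrite -[a.+1]/(val (Ordinal a1r)) nrowE mxE (bigD1 (Ordinal a1r)) //=.
  rewrite !mxE eqxx mul1r big1 ?addr0 // => b /negbTE nb.
  by rewrite -(inj_eq val_inj) /= in nb; rewrite !mxE nb mul0r.
rewrite nrow_out // mxE big1 // => b _; rewrite !mxE.
by rewrite ltn_eqF ?mul0r // (leq_trans (ltn_ord b) ra1).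
Qed.

Section Krylov.
Variables (F : fieldType) (m n : nat) (B1 B2 : 'M[F]_n) (I : 'M[F]_(m, n)).

Fixpoint krylov k : 'M[F]_n :=
  if k is k'.+1 then (krylov k' + krylov k' *m B1 + krylov k' *m B2)%MS
  else <<I>>%MS.

Lemma krylovS k : (krylov k <= krylov k.+1)%MS.
Proof. by rewrite /= -addsmxA addsmxSl. Qed.

Lemma sub_krylov k : (I <= krylov k)%MS.
Proof. by elim: k => [|k IH]; [rewrite /= genmxE | apply: submx_trans IH (krylovS k)]. Qed.

Lemma krylovMB1 k : (krylov k *m B1 <= krylov k.+1)%MS.
Proof. by rewrite /= -addsmxA (submx_trans (addsmxSl _ _) (addsmxSr _ _)). Qed.

Lemma krylovMB2 k : (krylov k *m B2 <= krylov k.+1)%MS.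
Proof. by rewrite /= addsmxSr. Qed.

Lemma krylov_min (S : 'M[F]_n) k : (I <= S)%MS -> stablemx S B1 ->
  stablemx S B2 -> (krylov k <= S)%MS.
Proof.
move=> IS sB1 sB2; elim: k => [|k IH] /=; first by rewrite genmxE.
by rewrite !addsmx_sub IH (submx_trans (submxMr _ IH)) // (submx_trans (submxMr _ IH)).
Qed.

(* The rank grows strictly until the sequence stabilises, and it is at most [n]. *)
Lemma krylov_stationary : (krylov n.+1 <= krylov n)%MS.
Proof.
have stays k : (krylov k.+1 <= krylov k)%MS -> (krylov k.+2 <= krylov k.+1)%MS.
  by move=> Kk; rewrite [krylov k.+2]/= addsmxS ?submxMr // addsmxS ?submxMr.
have grows k : (exists2 l, (l < k)%N & (krylov l.+1 <= krylov l)%MS)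
               \/ (k <= \rank (krylov k))%N.
  elim: k => [|k [[l lk Kl]|IH]]; [by right | by left; exists l => //; exact: ltnW|].
  have [Kk|Kk] := boolP (krylov k.+1 <= krylov k)%MS; first by left; exists k.
  by right; apply: leq_ltn_trans IH _; rewrite (ltn_leqif (mxrank_leqif_sup (krylovS k))).
case: (grows n.+1) => [[l ln Kl]|]; last by rewrite ltnNge rank_leq_col.
have from_l d : (krylov (l + d).+1 <= krylov (l + d))%MS.
  by elim: d => [|d IH]; rewrite ?addn0 // addnS stays.
by have := from_l (n - l)%N; rewrite subnKC // -ltnS.
Qed.

Lemma stablemx_krylovB1 : stablemx (krylov n) B1.
Proof. exact: submx_trans (krylovMB1 n) krylov_stationary. Qed.

Lemma stablemx_krylovB2 : stablemx (krylov n) B2.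
Proof. exact: submx_trans (krylovMB2 n) krylov_stationary. Qed.

Lemma stablemx_krylov_comm (B3 : 'M[F]_n) k : stablemx I B3 ->
  B1 *m B3 = B3 *m B1 -> B2 *m B3 = B3 *m B2 -> stablemx (krylov k) B3.
Proof.
move=> IB3 c1 c2; elim: k => [|k IH] /=.
  by rewrite genmxE (eqmxMr _ (genmxE I)).
rewrite addsmxMr addsmx_sub addsmxMr addsmx_sub -andbA; apply/and3P; split.
- exact: submx_trans IH (krylovS k).
- by rewrite -mulmxA c1 mulmxA (submx_trans (submxMr _ IH)) ?krylovMB1.
- by rewrite -mulmxA c2 mulmxA (submx_trans (submxMr _ IH)) ?krylovMB2.
Qed.

End Krylov.

(* The standard basis of [F^m] labelled by the entries of a duplicate-free
   list [L]; [evec t] is the basis vector labelled [t], and [0] if [t \notin L]. *)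
Section LabelledBasis.
Variables (F : fieldType) (T : eqType) (t0 : T) (m : nat) (L : seq T).
Hypotheses (size_L : size L = m) (uniq_L : uniq L).

Definition label (k : 'I_m) : T := nth t0 L k.
Definition evec (t : T) : 'rV[F]_m := \row_k (label k == t)%:R.
Definition mx_of_rows p (phi : T -> 'rV[F]_p) : 'M[F]_(m, p) := \matrix_k phi (label k).

Lemma label_mem k : label k \in L.
Proof. by rewrite mem_nth // size_L. Qed.

Lemma label_inj : injective label.
Proof. by move=> k l /eqP; rewrite nth_uniq ?size_L // => /eqP /val_inj. Qed.

Lemma label_index t : t \in L -> {k | label k = t}.
Proof.
move=> tL; have kL : (index t L < m)%N by rewrite -size_L index_mem.
by exists (Ordinal kL); rewrite /label nth_index.
Qed.

Lemma evec_label k : evec (label k) = delta_mx 0 k.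
Proof. by apply/rowP => l; rewrite !mxE (inj_eq label_inj) eq_sym. Qed.

Lemma evec_notin t : t \notin L -> evec t = 0.
Proof.
move=> tL; apply/rowP => l; rewrite !mxE.
by case: eqP => // lt; move: tL; rewrite -lt label_mem.
Qed.

Lemma evec_eq0 t : (evec t == 0) = (t \notin L).
Proof.
have [tL|/evec_notin ->] := boolP (t \in L); last by rewrite eqxx.
have [k <-] := label_index tL.
rewrite evec_label; apply/eqP => /matrixP /(_ 0 k).
by rewrite !mxE !eqxx => /eqP; rewrite oner_eq0.
Qed.

Lemma evec_mx_of_rows p (phi : T -> 'rV[F]_p) t :
  evec t *m mx_of_rows phi = if t \in L then phi t else 0.
Proof.
case: ifP => [tL|/negbT/evec_notin ->]; last by rewrite mul0mx.
by have [k <-] := label_index tL; rewrite evec_label -rowE rowK.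
Qed.

Lemma row_evec p (A : 'M[F]_(m, p)) k : row k A = evec (label k) *m A.
Proof. by rewrite evec_label rowE. Qed.

Lemma evec_mx_eq p (A B : 'M[F]_(m, p)) :
  (forall t, t \in L -> evec t *m A = evec t *m B) -> A = B.
Proof. by move=> eqAB; apply/row_matrixP => k; rewrite !row_evec eqAB ?label_mem. Qed.

Lemma mx_of_rows_evec : mx_of_rows evec = 1%:M.
Proof. by apply/row_matrixP => k; rewrite rowK evec_label rowE mulmx1. Qed.

Lemma evec_shift (s : T -> T) : (forall t, s t \in L -> t \in L) ->
  forall t, evec t *m mx_of_rows (evec \o s) = evec (s t).
Proof.
move=> sL t; rewrite evec_mx_of_rows; case: ifP => //= /negbT tL.
by rewrite evec_notin //; apply: contra tL; exact: sL.
Qed.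

Definition diag_of (f : T -> F) : 'M[F]_m := diag_mx (\row_k f (label k)).

Lemma evec_diag_of f t : evec t *m diag_of f = f t *: evec t.
Proof.
have [tL|/evec_notin ->] := boolP (t \in L); last by rewrite mul0mx scaler0.
by have [k <-] := label_index tL; rewrite evec_label -rowE row_diag_mx mxE.
Qed.

Lemma diag_of_unit f : {in L, forall t, f t != 0} -> diag_of f \in unitmx.
Proof.
move=> f_nz; rewrite unitmxE det_diag unitfE; apply/prodf_neq0 => k _.
by rewrite mxE f_nz ?label_mem.
Qed.

Lemma row_full_spanned (S : 'M[F]_m) : {in L, forall t, (evec t <= S)%MS} -> row_full S.
Proof.
move=> sub_S; rewrite -sub1mx -mx_of_rows_evec; apply/row_subP => k.
by rewrite rowK sub_S ?label_mem.
Qed.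

End LabelledBasis.

Definition succx (t : box) : box := (t.1, (t.2.1.+1, t.2.2)).
Definition succy (t : box) : box := (t.1, (t.2.1, t.2.2.+1)).
Definition succa (t : box) : box := (t.1.+1, t.2).

(* [mono t] for the box [t = (a, (i, j))] is the vector [I(e_a) B1^i B2^j],
   the image of the monomial [x^i y^j] of the [a]-th summand. *)
Definition mono (F : fieldType) r n (B1 B2 : 'M[F]_n) (I : 'M[F]_(r, n)) (t : box) :
  'rV[F]_n := nrow I t.1 *m B1 ^+ t.2.1 *m B2 ^+ t.2.2.

Section Monomials.
Variables (F : fieldType) (r n : nat) (B1 B2 : 'M[F]_n) (I : 'M[F]_(r, n)).
Local Notation mono := (mono B1 B2 I).

Lemma mono_frame a : mono (a, (0%N, 0%N)) = nrow I a.
Proof. by rewrite /mono !expr0 !mulmx1. Qed.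

Lemma mono_out t : (r <= t.1)%N -> mono t = 0.
Proof. by move=> rt; rewrite /mono nrow_out ?mul0mx. Qed.

Lemma mono_succy a i j : mono (a, (i, j.+1)) = mono (a, (i, j)) *m B2.
Proof. by rewrite /mono exprSr -mulmxE mulmxA. Qed.

Lemma mono_succx0 a i : mono (a, (i.+1, 0%N)) = mono (a, (i, 0%N)) *m B1.
Proof. by rewrite /mono /= !expr0 !mulmx1 exprSr -mulmxE mulmxA. Qed.

Lemma mono_succx a i j : B1 *m B2 = B2 *m B1 ->
  mono (a, (i.+1, j)) = mono (a, (i, j)) *m B1.
Proof.
by move=> comm12; rewrite /mono /= exprSr -mulmxE -!mulmxA (intertwineX j comm12).
Qed.

Lemma mono_sub (S : 'M[F]_n) t : (I <= S)%MS -> stablemx S B1 ->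
  stablemx S B2 -> (mono t <= S)%MS.
Proof.
case: t => a [i j] IS sB1 sB2.
elim: j => [|j IH]; last by rewrite mono_succy (submx_trans (submxMr _ IH)).
elim: i => [|i IH]; first by rewrite mono_frame (submx_trans (nrow_sub _ _)).
by rewrite mono_succx0 (submx_trans (submxMr _ IH)).
Qed.

End Monomials.

Lemma mono_conj (F : fieldType) r n (B1 B2 B1' B2' g : 'M[F]_n) (I I' : 'M[F]_(r, n)) :
  g *m B1' = B1 *m g -> g *m B2' = B2 *m g -> I' = I *m g ->
  forall t, mono B1' B2' I' t = mono B1 B2 I t *m g.
Proof.
move=> e1 e2 e3 [a [i j]]; rewrite /mono /= e3 nrowMr -!mulmxA; congr (_ *m _).
by rewrite mulmxA (intertwineX i e1) -mulmxA (intertwineX j e2).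
Qed.

Section Alpha.
Variables (F : closedFieldType) (r n : nat) (mu : r.-tuple (seq nat)).
Hypothesis mu_rpart : rpartition n mu.

Local Notation L := (rboxes mu).
Local Notation evec := (evec F box0 n L).
Local Notation mx_of_rows := (mx_of_rows box0 n L).
Local Notation al := (alpha F n mu).

Lemma size_rboxes_rpartition : size L = n.
Proof. by rewrite size_rboxes; case: mu_rpart. Qed.

Lemma rpartition_nth a : (a < r)%N -> is_partition (nth [::] mu a).
Proof. by case: mu_rpart => /allP mu_part _ ar; rewrite mu_part ?mem_nth ?size_tuple. Qed.

Lemma succx_mem t : succx t \in L -> t \in L.
Proof.
case: t => a [i j]; rewrite !mem_rboxes => /andP [ar ji1]; rewrite ar.
exact: leq_trans ji1 (partition_nthS _ (rpartition_nth ar)).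
Qed.

Lemma succy_mem t : succy t \in L -> t \in L.
Proof. by case: t => a [i j]; rewrite !mem_rboxes => /andP [-> /ltnW]. Qed.

Lemma evec_alphaB1 t : evec t *m aB1 al = evec (succx t).
Proof.
have -> : aB1 al = mx_of_rows (evec \o succx) by apply/matrixP => k l; rewrite !mxE.
exact: (evec_shift F box0 size_rboxes_rpartition (uniq_rboxes mu) succx_mem t).
Qed.

Lemma evec_alphaB2 t : evec t *m aB2 al = evec (succy t).
Proof.
have -> : aB2 al = mx_of_rows (evec \o succy) by apply/matrixP => k l; rewrite !mxE.
exact: (evec_shift F box0 size_rboxes_rpartition (uniq_rboxes mu) succy_mem t).
Qed.

Lemma nrow_alphaI a : nrow (aI al) a = evec (a, (0%N, 0%N)).
Proof.
case: (ltnP a r) => [ar|ra].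
  by rewrite -[a]/(val (Ordinal ar)) nrowE; apply/rowP => k; rewrite !mxE.
rewrite nrow_out // (evec_notin F _ size_rboxes_rpartition) //.
by apply: contraTN ra => /rboxes_lt /=; rewrite -ltnNge.
Qed.

Lemma alpha_comm : aB1 al *m aB2 al = aB2 al *m aB1 al.
Proof.
apply: (evec_mx_eq (t0 := box0) size_rboxes_rpartition (uniq_rboxes mu)) => t _.
by rewrite !mulmxA !evec_alphaB1 !evec_alphaB2 evec_alphaB1.
Qed.

Lemma mono_alpha t : mono (aB1 al) (aB2 al) (aI al) t = evec t.
Proof.
case: t => a [i j]; elim: j => [|j IH]; last by rewrite mono_succy IH evec_alphaB2.
elim: i => [|i IH]; first by rewrite mono_frame nrow_alphaI.
by rewrite mono_succx0 IH evec_alphaB1.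
Qed.

Lemma mem_rboxes_mono t : (t \in L) = (mono (aB1 al) (aB2 al) (aI al) t != 0).
Proof. by rewrite mono_alpha (evec_eq0 F _ size_rboxes_rpartition (uniq_rboxes mu)) negbK. Qed.

Lemma alpha_point : A_point al.
Proof.
split; first by rewrite /adhm_eq alpha_comm subrr add0r mul0mx.
move=> S IS sB1 sB2.
apply: (row_full_spanned (t0 := box0) size_rboxes_rpartition (uniq_rboxes mu)) => t _.
by rewrite -mono_alpha mono_sub.
Qed.

End Alpha.

Section Isomorphisms.
Variables (F : closedFieldType) (r n : nat).
Implicit Types (x : adhm F r n) (y : cyc F r n).

Definition intertwines x x' (g : 'M[F]_n) :=
  [/\ g *m aB1 x' = aB1 x *m g, g *m aB2 x' = aB2 x *m g,
      aI x' = aI x *m g & g *m aJ x' = aJ x].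

Lemma isoAP x x' : isoA x x' <-> exists2 g, g \in unitmx & intertwines x x' g.
Proof.
split=> [[g gu [e1 e2 e3 e4]]|[g gu [e1 e2 e3 e4]]]; exists g => //.
  by split; rewrite -?invmx_conjP -?invmx_mulP.
by split; rewrite ?invmx_conjP ?invmx_mulP.
Qed.

Lemma isoA_refl x : isoA x x.
Proof. by apply/isoAP; exists 1%:M; rewrite ?unitmx1 //; split; rewrite ?mul1mx ?mulmx1. Qed.

Lemma isoA_sym x x' : isoA x x' -> isoA x' x.
Proof.
case/isoAP => g gu [e1 e2 e3 e4]; apply/isoAP; exists (invmx g); first by rewrite unitmx_inv.
split; rewrite ?e3 ?mulmxK // -?e4 ?mulKmx //.
  by rewrite (proj2 (invmx_conjP _ _ gu) e1) mulmxK.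
by rewrite (proj2 (invmx_conjP _ _ gu) e2) mulmxK.
Qed.

Lemma isoA_trans x x' x'' : isoA x x' -> isoA x' x'' -> isoA x x''.
Proof.
case/isoAP => g gu [e1 e2 e3 e4] /isoAP [h hu [f1 f2 f3 f4]].
apply/isoAP; exists (g *m h); first by rewrite unitmx_mul gu.
split.
- by rewrite -mulmxA f1 mulmxA e1 mulmxA.
- by rewrite -mulmxA f2 mulmxA e2 mulmxA.
- by rewrite f3 e3 mulmxA.
- by rewrite -mulmxA f4 e4.
Qed.

Lemma actA_I t1 t2 (u : 'I_r -> F) x :
  aI (actA t1 t2 u x) = diag_mx (\row_a (u a)^-1) *m aI x.
Proof. by rewrite mul_diag_mx; apply/matrixP => a k; rewrite !mxE. Qed.

Lemma actA_J t1 t2 (u : 'I_r -> F) x :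
  aJ (actA t1 t2 u x) = aJ x *m diag_mx (\row_a (t1 * t2 * u a)).
Proof. by rewrite mul_mx_diag; apply/matrixP => a k; rewrite !mxE mulrC. Qed.

Lemma isoA_act t1 t2 u x x' : isoA x x' -> isoA (actA t1 t2 u x) (actA t1 t2 u x').
Proof.
case/isoAP => g gu [e1 e2 e3 e4]; apply/isoAP; exists g => //.
by split; rewrite ?actA_I ?actA_J /= -?scalemxAr ?e1 ?e2 ?e3 ?scalemxAl ?mulmxA ?e4.
Qed.

Lemma fixedA_Tr2_iso x x' : isoA x x' -> fixedA_Tr2 x' -> fixedA_Tr2 x.
Proof.
move=> xx' fx' t1 t2 u t1_nz t2_nz u_nz; apply: isoA_trans (isoA_act t1 t2 u xx') _.
exact: isoA_trans (fx' _ _ _ t1_nz t2_nz u_nz) (isoA_sym xx').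
Qed.

Lemma isoA_forget y y' : isoQ y y' -> isoA (forget y) (forget y').
Proof. by case=> g gu [e1 e2 _ e4 e5]; exists g. Qed.

Lemma forget_actQ t1 t2 t3 y :
  forget (actQ t1 t2 t3 y) = actA t1 t2 (Tu t3) (forget y).
Proof. by congr ADHM; apply/matrixP => a k; rewrite !mxE /Tu invrK. Qed.

Lemma fixedA_T_forget y : fixedQ_T y -> fixedA_T (forget y).
Proof.
by move=> fy t1 t2 t3 t1_nz t2_nz t3_nz; rewrite -forget_actQ; apply/isoA_forget/fy.
Qed.

Lemma mono_intertwines x x' g : intertwines x x' g ->
  forall t, mono (aB1 x') (aB2 x') (aI x') t = mono (aB1 x) (aB2 x) (aI x) t *m g.
Proof. by case=> e1 e2 e3 _; apply: mono_conj. Qed.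

Lemma mono_intertwines_eq0 x x' g : g \in unitmx -> intertwines x x' g ->
  forall t, (mono (aB1 x') (aB2 x') (aI x') t == 0) = (mono (aB1 x) (aB2 x) (aI x) t == 0).
Proof.
by move=> g_unit g_int t; rewrite (mono_intertwines g_int) mulmx_free_eq0 // row_free_unit.
Qed.

End Isomorphisms.

(* The diagonal matrix with these entries, [c a] standing for [u_a], realises
   the action of [(t1, t2, u)] on [alpha_mu]. *)
Definition box_weight (F : fieldType) (t1 t2 : F) (c : nat -> F) (t : box) : F :=
  c t.1 / (t1 ^+ t.2.1 * t2 ^+ t.2.2).

Section AlphaFixed.
Variables (F : closedFieldType) (r n : nat) (mu : r.-tuple (seq nat)).
Hypothesis mu_rpart : rpartition n mu.
Variables (t1 t2 : F) (c : nat -> F).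
Hypotheses (t1_nz : t1 != 0) (t2_nz : t2 != 0).

Local Notation L := (rboxes mu).
Local Notation sL := (size_rboxes_rpartition mu_rpart).
Local Notation evec := (evec F box0 n L).
Local Notation al := (alpha F n mu).
Local Notation D := (diag_of box0 n L (box_weight t1 t2 c)).

Lemma box_weight_succx t : box_weight t1 t2 c t = t1 * box_weight t1 t2 c (succx t).
Proof. by rewrite /box_weight /= exprS; field; rewrite !expf_neq0 ?t1_nz ?t2_nz. Qed.

Lemma box_weight_succy t : box_weight t1 t2 c t = t2 * box_weight t1 t2 c (succy t).
Proof. by rewrite /box_weight /= exprS; field; rewrite !expf_neq0 ?t1_nz ?t2_nz. Qed.

Lemma box_weight_frame a : box_weight t1 t2 c (a, (0%N, 0%N)) = c a.
Proof. by rewrite /box_weight /= !expr0 mulr1 divr1. Qed.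

Lemma box_weight_unit : (forall a, (a < r)%N -> c a != 0) -> D \in unitmx.
Proof.
move=> c_nz; apply: (diag_of_unit _ sL) => t /rboxes_lt tr.
by rewrite /box_weight mulf_neq0 ?invr_eq0 ?c_nz ?mulf_neq0 ?expf_neq0.
Qed.

Lemma evec_box_weight t : evec t *m D = box_weight t1 t2 c t *: evec t.
Proof. exact: evec_diag_of sL (uniq_rboxes mu) _ t. Qed.

Lemma box_weight_B1 : D *m aB1 al = (t1 *: aB1 al) *m D.
Proof.
apply: (evec_mx_eq (t0 := box0) sL (uniq_rboxes mu)) => t _.
rewrite !mulmxA evec_box_weight -scalemxAl (evec_alphaB1 F mu_rpart) -scalemxAr -scalemxAl.
by rewrite (evec_alphaB1 F mu_rpart) evec_box_weight scalerA -box_weight_succx.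
Qed.

Lemma box_weight_B2 : D *m aB2 al = (t2 *: aB2 al) *m D.
Proof.
apply: (evec_mx_eq (t0 := box0) sL (uniq_rboxes mu)) => t _.
rewrite !mulmxA evec_box_weight -scalemxAl (evec_alphaB2 F mu_rpart) -scalemxAr -scalemxAl.
by rewrite (evec_alphaB2 F mu_rpart) evec_box_weight scalerA -box_weight_succy.
Qed.

Lemma row_alphaI_box_weight (a : 'I_r) : row a (aI al) *m D = c a *: row a (aI al).
Proof. by rewrite -nrowE (nrow_alphaI F mu_rpart) evec_box_weight box_weight_frame. Qed.

End AlphaFixed.

Lemma alpha_fixed (F : closedFieldType) r n (mu : r.-tuple (seq nat)) :
  rpartition n mu -> fixedA_Tr2 (alpha F n mu).
Proof.
move=> mu_rpart t1 t2 u t1_nz t2_nz u_nz.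
pose c a : F := oapp u 1 (insub a).
have cE (a : 'I_r) : c a = u a by rewrite /c valK.
apply/isoAP; exists (diag_of box0 n (rboxes mu) (box_weight t1 t2 c)).
  by apply: box_weight_unit => // a ar; rewrite -[a]/(val (Ordinal ar)) cE.
split; [exact: box_weight_B1 | exact: box_weight_B2 | |].
  apply/row_matrixP => a; rewrite actA_I row_mul row_diag_mul -scalemxAl.
  by rewrite row_alphaI_box_weight // scalerA cE mxE mulVf ?scale1r.
by rewrite actA_J /= mulmx0 mul0mx.
Qed.

Definition box_eigenvalue (F : fieldType) (t1 t2 t3 : F) (t : box) : F :=
  (t3 ^+ t.1 * t1 ^+ t.2.1 * t2 ^+ t.2.2)^-1.

Section TorusFixedPoint.
Variables (F : closedFieldType) (r n : nat) (x : adhm F r n).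
Hypothesis x_point : A_point x.
Variables (t1 t2 t3 : F) (g : 'M[F]_n).
Hypotheses (t1_nz : t1 != 0) (t2_nz : t2 != 0) (t3_nz : t3 != 0).
Hypothesis g_fix : intertwines (actA t1 t2 (Tu t3) x) x g.

Local Notation B1 := (aB1 x).
Local Notation B2 := (aB2 x).
Local Notation I := (aI x).
Local Notation J := (aJ x).
Local Notation lambda := (box_eigenvalue t1 t2 t3).
Local Notation mono := (mono B1 B2 I).

Hypothesis lambda_inj : injective lambda.
Hypothesis lambda_neq_J : forall t a, lambda t != t1 * t2 * (t3 ^+ a)^-1.

Lemma B1_g : B1 *m g = t1^-1 *: (g *m B1).
Proof. by case: g_fix => -> _ _ _; rewrite /= -scalemxAl scalerA mulVf ?scale1r. Qed.

Lemma B2_g : B2 *m g = t2^-1 *: (g *m B2).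
Proof. by case: g_fix => _ -> _ _; rewrite /= -scalemxAl scalerA mulVf ?scale1r. Qed.

Lemma eigen_B1 m (V : 'M[F]_(m, n)) c : V *m g = c *: V ->
  (V *m B1) *m g = (t1^-1 * c) *: (V *m B1).
Proof. by move=> Vg; rewrite -mulmxA B1_g -scalemxAr mulmxA Vg -scalemxAl scalerA. Qed.

Lemma eigen_B2 m (V : 'M[F]_(m, n)) c : V *m g = c *: V ->
  (V *m B2) *m g = (t2^-1 * c) *: (V *m B2).
Proof. by move=> Vg; rewrite -mulmxA B2_g -scalemxAr mulmxA Vg -scalemxAl scalerA. Qed.

Lemma nrowI_g a : nrow I a *m g = lambda (a, (0%N, 0%N)) *: nrow I a.
Proof.
rewrite /box_eigenvalue /= !expr0 !mulr1.
case: (ltnP a r) => [ar|ra]; last by rewrite nrow_out ?mul0mx ?scaler0.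
case: g_fix => _ _ + _; rewrite actA_I => /(congr1 (row (Ordinal ar))).
rewrite row_mul row_diag_mul mxE /Tu invrK -nrowE /= => Ia.
by rewrite {2}Ia -scalemxAl scalerA mulVf ?scale1r ?expf_neq0.
Qed.

Lemma lambda_succx a i j : lambda (a, (i.+1, j)) = t1^-1 * lambda (a, (i, j)).
Proof. by rewrite /box_eigenvalue /= exprS -invfM; congr (_^-1); ring. Qed.

Lemma lambda_succy a i j : lambda (a, (i, j.+1)) = t2^-1 * lambda (a, (i, j)).
Proof. by rewrite /box_eigenvalue /= exprS -invfM; congr (_^-1); ring. Qed.

Definition eigensum k : 'M[F]_n :=
  (\sum_(t : 'I_r * 'I_k.+1 * 'I_k.+1)
     eigenspace g (lambda (val t.1.1, (val t.1.2, val t.2))))%MS.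

Lemma eigensum_sup k a i j m (V : 'M[F]_(m, n)) : (a < r)%N -> (i <= k)%N -> (j <= k)%N ->
  V *m g = lambda (a, (i, j)) *: V -> (V <= eigensum k)%MS.
Proof.
move=> ar ik jk Vg; have ik' : (i < k.+1)%N by []; have jk' : (j < k.+1)%N by [].
by apply: (sumsmx_sup (Ordinal ar, Ordinal ik', Ordinal jk')) => //; apply/eigenspaceP.
Qed.

Lemma krylov_eigensum k : (krylov B1 B2 I k <= eigensum k)%MS.
Proof.
elim: k => [|k IH] /=.
  rewrite genmxE; apply/row_subP => a.
  by apply: (@eigensum_sup 0 a 0 0) => //; rewrite -nrowE nrowI_g.
rewrite !addsmx_sub -andbA; apply/and3P; split.
- apply: submx_trans IH _; apply/sumsmx_subP => -[[a i] j] _.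
  apply: (eigensum_sup (ltn_ord a) (ltnW (ltn_ord i)) (ltnW (ltn_ord j))).
  exact/eigenspaceP.
- apply: submx_trans (submxMr _ IH) _; rewrite sumsmxMr; apply/sumsmx_subP => -[[a i] j] _.
  apply: (eigensum_sup (ltn_ord a) (ltn_ord i) (ltnW (ltn_ord j))).
  by rewrite lambda_succx; apply/eigen_B1/eigenspaceP.
- apply: submx_trans (submxMr _ IH) _; rewrite sumsmxMr; apply/sumsmx_subP => -[[a i] j] _.
  apply: (eigensum_sup (ltn_ord a) (ltnW (ltn_ord i)) (ltn_ord j)).
  by rewrite lambda_succy; apply/eigen_B2/eigenspaceP.
Qed.

(* [g J = J diag(t1 t2 t3^-a)], and no [lambda t] is among these eigenvalues. *)
Lemma eigenvector_J m (V : 'M[F]_(m, n)) t : V *m g = lambda t *: V -> V *m J = 0.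
Proof.
move=> Vg; pose D : 'M[F]_r := diag_mx (\row_a (t1 * t2 * (t3 ^+ a)^-1 - lambda t)).
have D_unit : D \in unitmx.
  by apply: diag_mx_unit => a; rewrite mxE subr_eq0 eq_sym lambda_neq_J.
have gJ : g *m J = J *m diag_mx (\row_a (t1 * t2 * (t3 ^+ a)^-1)).
  by case: g_fix => _ _ _ ->; rewrite actA_J /Tu.
have : (V *m J) *m D = 0.
  have -> : D = diag_mx (\row_a (t1 * t2 * (t3 ^+ a)^-1)) - lambda t *: 1%:M.
    by apply/matrixP => i j; rewrite !mxE; case: (i == j); rewrite ?mulr1 ?mulr0 ?subr0.
  by rewrite mulmxBr -mulmxA -gJ mulmxA Vg -scalemxAl -scalemxAr mulmx1 subrr.
by move/(congr1 (mulmx^~ (invmx D))); rewrite mulmxK // mul0mx.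
Qed.

Lemma J_eq0 : J = 0.
Proof.
case: x_point => _ stab.
have K_full : row_full (krylov B1 B2 I n).
  by apply: stab; [exact: sub_krylov | exact: stablemx_krylovB1 | exact: stablemx_krylovB2].
have E_full : row_full (eigensum n).
  by rewrite -sub1mx (submx_trans _ (krylov_eigensum n)) // sub1mx.
have : (eigensum n <= kermx J)%MS.
  apply/sumsmx_subP => -[[a i] j] _; rewrite sub_kermx.
  by apply/eqP/(eigenvector_J (t := (val a, (val i, val j))))/eigenspaceP.
by move/(submx_trans (submx_full 1%:M E_full)); rewrite sub_kermx mul1mx => /eqP.
Qed.

Lemma B_comm : B1 *m B2 = B2 *m B1.
Proof.
by case: x_point; rewrite /adhm_eq J_eq0 mul0mx addr0 => /eqP; rewrite subr_eq0 => /eqP ->.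
Qed.

Lemma mono_succx_box t : mono (succx t) = mono t *m B1.
Proof. by case: t => a [i j]; rewrite (mono_succx _ _ _ _ B_comm). Qed.

Lemma mono_succy_box t : mono (succy t) = mono t *m B2.
Proof. by case: t => a [i j]; rewrite mono_succy. Qed.

Lemma mono_eigen t : mono t *m g = lambda t *: mono t.
Proof.
case: t => a [i j]; elim: j => [|j IH]; last by rewrite mono_succy lambda_succy (eigen_B2 IH).
elim: i => [|i IH]; first by rewrite mono_frame nrowI_g.
by rewrite mono_succx0 lambda_succx (eigen_B1 IH).
Qed.

(* Nonzero [mono t] are eigenvectors for pairwise distinct eigenvalues. *)
Lemma size_mono_nz (T : seq box) : uniq T -> {in T, forall t, mono t != 0} ->
  (size T <= n)%N.
Proof.
move=> uT T_nz; have := @max_poly_roots _ (char_poly g) (map lambda T).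
rewrite size_char_poly size_map ltnS; apply.
- exact: monic_neq0 (char_poly_monic g).
- apply/allP => _ /mapP [t tT ->]; rewrite -eigenvalue_root_char.
  by apply/eigenvalueP; exists (mono t); [exact: mono_eigen | exact: T_nz].
- by rewrite map_inj_uniq.
Qed.

Lemma mono_nz_downx a i d j : mono (a, ((i + d)%N, j)) != 0 -> mono (a, (i, j)) != 0.
Proof.
elim: d => [|d IH]; rewrite ?addn0 // addnS (mono_succx _ _ _ _ B_comm) => nz.
by apply: IH; apply: contraNneq nz => ->; rewrite mul0mx.
Qed.

Lemma mono_nz_downy a i j d : mono (a, (i, (j + d)%N)) != 0 -> mono (a, (i, j)) != 0.
Proof.
elim: d => [|d IH]; rewrite ?addn0 // addnS mono_succy => nz.
by apply: IH; apply: contraNneq nz => ->; rewrite mul0mx.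
Qed.

Lemma mono_nz_bound a i j : mono (a, (i, j)) != 0 -> (i < n)%N && (j < n)%N.
Proof.
move=> nz; apply/andP; split.
  have := @size_mono_nz [seq (a, (k, j)) | k <- iota 0 i.+1].
  rewrite size_map size_iota; apply; first by rewrite map_inj_uniq ?iota_uniq // => k l [].
  move=> t /mapP [k]; rewrite mem_iota add0n => /andP [_ ki] ->.
  by apply: (@mono_nz_downx a k (i - k)); rewrite subnKC.
have := @size_mono_nz [seq (a, (i, k)) | k <- iota 0 j.+1].
rewrite size_map size_iota; apply; first by rewrite map_inj_uniq ?iota_uniq // => k l [].
move=> t /mapP [k]; rewrite mem_iota add0n => /andP [_ kj] ->.
by apply: (@mono_nz_downy a i k (j - k)); rewrite subnKC.
Qed.

Definition fixed_partition : r.-tuple (seq nat) :=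
  [tuple diagram_of (fun i j => mono (val a, (i, j)) != 0) n | a < r].

Lemma mem_fixed_rboxes t : (t \in rboxes fixed_partition) = (mono t != 0).
Proof.
case: t => a [i j]; rewrite mem_rboxes.
case: (ltnP a r) => [ar|ra]; last by rewrite andFb mono_out ?eqxx.
rewrite andTb -[a]/(val (Ordinal ar)) -(tnth_nth [::]) tnth_mktuple -mem_diagram_of //.
- by move=> k l; rewrite -[k.+1]addn1; apply: mono_nz_downx.
- by move=> k l; rewrite -[l.+1]addn1; apply: mono_nz_downy.
- exact: mono_nz_bound.
Qed.

Local Notation LX := (rboxes fixed_partition).

Lemma evec_fixed_rboxes m (size_LX : size LX = m) t :
  evec F box0 m LX t *m mx_of_rows box0 m LX mono = mono t.
Proof.
by rewrite (evec_mx_of_rows box0 size_LX (uniq_rboxes _)) mem_fixed_rboxes; case: eqP.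
Qed.

Lemma fixed_rboxes_full m (size_LX : size LX = m) : row_full (mx_of_rows box0 m LX mono).
Proof.
set P := mx_of_rows _ _ _ _.
have mono_P t : (mono t <= P)%MS by rewrite -(evec_fixed_rboxes size_LX) submxMl.
rewrite /row_full -genmxE; case: x_point => _; apply; rewrite ?(eqmxMr _ (genmxE _)) genmxE.
- by apply/row_subP => a; rewrite -nrowE -(mono_frame B1 B2) mono_P.
- by apply/row_subP => k; rewrite row_mul rowK -mono_succx_box mono_P.
- by apply/row_subP => k; rewrite row_mul rowK -mono_succy_box mono_P.
Qed.

Lemma size_fixed_rboxes : size LX = n.
Proof.
apply/eqP; rewrite eqn_leq size_mono_nz ?uniq_rboxes //=; last first.
  by move=> t; rewrite mem_fixed_rboxes.
by have /eqP <- := fixed_rboxes_full (erefl (size LX)); exact: rank_leq_row.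
Qed.

Lemma fixed_partition_rpartition : rpartition n fixed_partition.
Proof.
split; last by rewrite -size_rboxes size_fixed_rboxes.
apply/allP => p /tnthP [a ->]; rewrite tnth_mktuple.
apply: diagram_of_partition => [i j|i j|]; last exact: mono_nz_bound.
  by rewrite -[i.+1]addn1; apply: mono_nz_downx.
by rewrite -[j.+1]addn1; apply: mono_nz_downy.
Qed.

Lemma alpha_fixed_partition_iso : isoA (alpha F n fixed_partition) x.
Proof.
have rp := fixed_partition_rpartition.
have evecP := evec_fixed_rboxes size_fixed_rboxes.
apply/isoAP; exists (mx_of_rows box0 n LX mono).
  by rewrite -row_full_unit (fixed_rboxes_full size_fixed_rboxes).
split.
- apply: (evec_mx_eq (t0 := box0) size_fixed_rboxes (uniq_rboxes _)) => t _.
  by rewrite !mulmxA evecP (evec_alphaB1 F rp) evecP mono_succx_box.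
- apply: (evec_mx_eq (t0 := box0) size_fixed_rboxes (uniq_rboxes _)) => t _.
  by rewrite !mulmxA evecP (evec_alphaB2 F rp) evecP mono_succy_box.
- by apply/row_matrixP => a; rewrite row_mul -!nrowE (nrow_alphaI F rp) evecP mono_frame.
- by rewrite J_eq0 mulmx0.
Qed.

End TorusFixedPoint.

Section CharZero.
Variables (F : closedFieldType) (charF0 : [pchar F] =i pred0).

Lemma natf_eq0 k : (k%:R == 0 :> F) = (k == 0)%N.
Proof. by have [/(_ charF0) -> _] := pcharf0P F. Qed.

Lemma natf_inj : injective (fun k : nat => k%:R : F).
Proof.
move=> k l; wlog kl : k l / (k <= l)%N => [wlog_kl|e].
  by case: (leqP k l) => [/wlog_kl//|/ltnW lk /esym /(wlog_kl _ _ lk)].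
by apply/eqP; rewrite eqn_leq kl /= -subn_eq0 -natf_eq0 natrB // e subrr.
Qed.

Definition box_code (t : box) : nat := 5 ^ t.1 * 2 ^ t.2.1 * 3 ^ t.2.2.

Lemma box_code_inj : injective box_code.
Proof.
have logn_code p t : prime p -> (p < 6)%N -> p != 4 ->
    logn p (box_code t) = ((p == 5) * t.1 + (p == 2) * t.2.1 + (p == 3) * t.2.2)%N.
  move=> p_pr p6 p4; rewrite !lognM ?muln_gt0 ?expn_gt0 // !lognX !logn_prime //.
  by rewrite ![(_ * (_ == _))%N]mulnC.
case=> a [i j] [a' [i' j']] e.
have := congr1 (logn 5) e; have := congr1 (logn 2) e; have := congr1 (logn 3) e.
by rewrite !logn_code //= !mul1n !mul0n !addn0 !add0n => -> -> ->.
Qed.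

Local Notation lambda := (box_eigenvalue (2%:R : F) 3%:R 5%:R).

Lemma box_eigenvalue_code t : lambda t = (box_code t)%:R^-1.
Proof. by rewrite /box_eigenvalue /box_code !natrM !natrX. Qed.

Lemma box_eigenvalue_inj : injective lambda.
Proof. by move=> t t'; rewrite !box_eigenvalue_code => /invr_inj /natf_inj /box_code_inj. Qed.

(* [5^a = 6 * box_code t] is impossible by parity. *)
Lemma box_eigenvalue_neq_J t (a : nat) : lambda t != 2%:R * 3%:R * (5%:R ^+ a)^-1.
Proof.
rewrite box_eigenvalue_code -natrX -natrM; apply/eqP => e.
have code_nz : (box_code t)%:R != 0 :> F by rewrite natf_eq0 !muln_eq0 !expn_eq0.
have : (5 ^ a)%:R = (2 * 3)%:R * (box_code t)%:R :> F.
  move: e => /(congr1 GRing.inv); rewrite invrK invf_div => ->.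
  by rewrite mulrC divfK // natf_eq0.
by rewrite -natrM => /natf_inj /(congr1 odd); rewrite oddX !oddM /= orbT.
Qed.

Lemma fixedA_T_classification r n (x : adhm F r n) : A_point x -> fixedA_T x ->
  aJ x = 0 /\ exists2 mu, rpartition n mu & isoA (alpha F n mu) x.
Proof.
move=> x_point fx.
have [t1_nz t2_nz t3_nz] : [/\ 2%:R != 0 :> F, 3%:R != 0 :> F & 5%:R != 0 :> F].
  by rewrite !natf_eq0.
case/isoAP: (fx _ _ _ t1_nz t2_nz t3_nz) => g _ g_fix.
have lambda_inj := box_eigenvalue_inj; have lambda_neq_J := box_eigenvalue_neq_J.
split; first exact (J_eq0 x_point t1_nz t2_nz t3_nz g_fix lambda_neq_J).
exists (fixed_partition x).
  exact (fixed_partition_rpartition x_point t1_nz t2_nz t3_nz g_fix lambda_inj lambda_neq_J).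
exact (alpha_fixed_partition_iso x_point t1_nz t2_nz t3_nz g_fix lambda_inj lambda_neq_J).
Qed.

End CharZero.

Lemma alpha_inj (F : closedFieldType) r n (mu nu : r.-tuple (seq nat)) :
  rpartition n mu -> rpartition n nu -> isoA (alpha F n mu) (alpha F n nu) -> mu = nu.
Proof.
move=> mu_rpart nu_rpart /isoAP [g g_unit g_int].
apply: (eq_rpartition_rboxes mu_rpart nu_rpart) => t.
rewrite (mem_rboxes_mono F mu_rpart) (mem_rboxes_mono F nu_rpart).
by rewrite (mono_intertwines_eq0 g_unit g_int).
Qed.

Section CyclicData.
Variables (F : closedFieldType) (r n : nat).
Implicit Types y : cyc F r n.

Lemma forget_point y : Q_point y -> A_point (forget y).
Proof.
case=> eq_y [_ IB3 c1 c2 stab]; split => //= S IS sB1 sB2.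
have K_full : row_full (krylov (cB1 y) (cB2 y) (cI y) n).
  apply: stab; [exact: sub_krylov | exact: stablemx_krylovB1 | exact: stablemx_krylovB2 |].
  by apply: stablemx_krylov_comm => //; rewrite IB3 submxMl.
by rewrite -sub1mx (submx_trans _ (krylov_min n IS sB1 sB2)) // sub1mx.
Qed.

Lemma mono_succa y : Q_point y -> forall a i j,
  mono (cB1 y) (cB2 y) (cI y) (a.+1, (i, j)) =
  mono (cB1 y) (cB2 y) (cI y) (a, (i, j)) *m cB3 y.
Proof.
case=> _ [_ IB3 c1 c2 _] a i j; rewrite /mono /= -nrow_shiftA -IB3 nrowMr -!mulmxA.
congr (_ *m _); by rewrite mulmxA (intertwineX i (esym c1)) -mulmxA (intertwineX j (esym c2)).
Qed.

(* [B3] maps [I(e_a) B1^i B2^j] to [I(e_{a+1}) B1^i B2^j], so [mu_{a+1}] lies in [mu_a]. *)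
Lemma nested_of_forget y mu : rpartition n mu -> Q_point y ->
  isoA (alpha F n mu) (forget y) -> nested mu.
Proof.
move=> mu_rpart y_point /isoAP [g g_unit g_int].
have mem_y t : (t \in rboxes mu) = (mono (cB1 y) (cB2 y) (cI y) t != 0).
  by rewrite (mem_rboxes_mono F mu_rpart) (mono_intertwines_eq0 g_unit g_int).
have succa_mem a i j : (a.+1, (i, j)) \in rboxes mu -> (a, (i, j)) \in rboxes mu.
  rewrite 2!mem_y (mono_succa y_point).
  by apply: contraNneq => ->; rewrite mul0mx.
move=> a a1r i; rewrite !(tnth_nth [::]) /=.
case e: (nth 0 (nth [::] mu a.+1) i) => [//|k].
by have := succa_mem a i k; rewrite !mem_rboxes /= a1r e ltnSn ltn_ord; apply.
Qed.

End CyclicData.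

Definition alpha_cyc (F : closedFieldType) r n (mu : r.-tuple (seq nat)) : cyc F r n :=
  CYC (aB1 (alpha F n mu)) (aB2 (alpha F n mu))
      (mx_of_rows box0 n (rboxes mu) (evec F box0 n (rboxes mu) \o succa))
      (aI (alpha F n mu)) 0.

Section AlphaCyc.
Variables (F : closedFieldType) (r n : nat) (mu : r.-tuple (seq nat)).
Hypotheses (mu_rpart : rpartition n mu) (mu_nested : nested mu).

Local Notation L := (rboxes mu).
Local Notation sL := (size_rboxes_rpartition mu_rpart).
Local Notation evec := (evec F box0 n L).
Local Notation al := (alpha F n mu).
Local Notation B3 := (cB3 (alpha_cyc F n mu)).

Lemma succa_mem t : succa t \in L -> t \in L.
Proof.
case: t => a [i j]; rewrite !mem_rboxes /= => /andP [a1r ji].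
have ar := ltnW a1r; rewrite ar; apply: leq_trans ji _.
by have := @mu_nested (Ordinal ar) a1r i; rewrite !(tnth_nth [::]).
Qed.

Lemma evec_alphaB3 t : evec t *m B3 = evec (succa t).
Proof. exact: (evec_shift F box0 sL (uniq_rboxes mu) succa_mem t). Qed.

Lemma alpha_cyc_point : Q_point (alpha_cyc F n mu).
Proof.
have [eq_al stab_al] := alpha_point F mu_rpart.
split=> //; split=> /=.
- by rewrite mulmx0 mul0mx.
- apply/row_matrixP => a; rewrite -!nrowE nrowMr nrow_shiftA !(nrow_alphaI F mu_rpart).
  exact: evec_alphaB3.
- apply: (evec_mx_eq (t0 := box0) sL (uniq_rboxes mu)) => t _.
  by rewrite !mulmxA evec_alphaB3 !(evec_alphaB1 F mu_rpart) evec_alphaB3.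
- apply: (evec_mx_eq (t0 := box0) sL (uniq_rboxes mu)) => t _.
  by rewrite !mulmxA evec_alphaB3 !(evec_alphaB2 F mu_rpart) evec_alphaB3.
- by move=> S IS sB1 sB2 _; exact: stab_al.
Qed.

Lemma alpha_cyc_fixed : fixedQ_T (alpha_cyc F n mu).
Proof.
move=> t1 t2 t3 t1_nz t2_nz t3_nz.
pose c a : F := (t3 ^+ a)^-1.
pose D := diag_of box0 n L (box_weight t1 t2 c).
have D_unit : D \in unitmx.
  by apply: box_weight_unit => // a _; rewrite invr_eq0 expf_neq0.
have evecD := evec_box_weight mu_rpart t1 t2 c.
exists D => //; split.
- exact/(invmx_conjP _ _ D_unit)/(box_weight_B1 mu_rpart c t1_nz t2_nz).
- exact/(invmx_conjP _ _ D_unit)/(box_weight_B2 mu_rpart c t1_nz t2_nz).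
- apply/(invmx_conjP _ _ D_unit)/(evec_mx_eq (t0 := box0) sL (uniq_rboxes mu)) => t _.
  rewrite /= !mulmxA evecD -scalemxAl evec_alphaB3 -scalemxAr -scalemxAl evec_alphaB3.
  rewrite evecD scalerA; congr (_ *: _); rewrite /box_weight /c /= exprS.
  by field; rewrite !expf_neq0 ?mulf_neq0 ?expf_neq0.
- apply/row_matrixP => a; rewrite row_mul /=.
  have -> : row a (\matrix_(b, k) (t3 ^+ b * aI al b k)) = t3 ^+ a *: row a (aI al).
    by apply/rowP => k; rewrite !mxE.
  by rewrite -scalemxAl row_alphaI_box_weight // scalerA mulfV ?scale1r ?expf_neq0.
- by apply/matrixP => k a; rewrite !mxE big1 // => l _; rewrite !mxE !mulr0.
Qed.

Lemma alpha_cyc_fixed_point :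
  [/\ Q_point (alpha_cyc F n mu), fixedQ_T (alpha_cyc F n mu)
    & isoA (forget (alpha_cyc F n mu)) al].
Proof. by split; [exact: alpha_cyc_point | exact: alpha_cyc_fixed | exact: isoA_refl]. Qed.

End AlphaCyc.

Lemma alpha_cyc_inj (F : closedFieldType) r n (mu nu : r.-tuple (seq nat)) :
  rpartition n mu -> rpartition n nu ->
  isoQ (alpha_cyc F n mu) (alpha_cyc F n nu) -> mu = nu.
Proof. by move=> mu_rpart nu_rpart /isoA_forget; apply: alpha_inj. Qed.

Lemma fixedQ_J_eq0 (F : closedFieldType) (charF0 : [pchar F] =i pred0) r n
    (y : cyc F r n) : Q_point y -> fixedQ_T y -> cJ y = 0.
Proof.
move=> y_point y_fixed.
by have [] := fixedA_T_classification charF0 (forget_point y_point) (fixedA_T_forget y_fixed).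
Qed.

Lemma isoQ_alpha_cyc (F : closedFieldType) (charF0 : [pchar F] =i pred0) r n
    (y : cyc F r n) : Q_point y -> fixedQ_T y ->
  exists2 mu, rpartition n mu /\ nested mu & isoQ y (alpha_cyc F n mu).
Proof.
move=> y_point y_fixed.
have [J0 [mu mu_rpart al_y]] :=
  fixedA_T_classification charF0 (forget_point y_point) (fixedA_T_forget y_fixed).
have mu_nested := nested_of_forget mu_rpart y_point al_y.
exists mu => //; case/isoAP: (isoA_sym al_y) => g g_unit g_int.
have [gB1 gB2 Ig _] := g_int.
exists g => //; split.
- exact/(invmx_conjP _ _ g_unit)/gB1.
- exact/(invmx_conjP _ _ g_unit)/gB2.
- apply: (evec_mx_eq (t0 := box0) (size_rboxes_rpartition mu_rpart) (uniq_rboxes mu)).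
  move=> -[a [i j]] _; rewrite (evec_alphaB3 F mu_rpart mu_nested).
  rewrite -!(mono_alpha F mu_rpart) !(mono_intertwines g_int) !mulmxA mulmxK //.
  by rewrite /= (mono_succa y_point).
- exact: Ig.
- by rewrite /= in J0; rewrite /= J0 mulmx0.
Qed.

Unset Implicit Arguments.

Theorem proposition4p1 (F : closedFieldType) (charF0 : [pchar F] =i pred0)
    (r n : nat) :
  (* (i) *)
  (forall x : adhm F r n, A_point x -> (fixedA_T x <-> fixedA_Tr2 x)) /\
  (* (ii) *)
  (forall mu : r.-tuple (seq nat), rpartition n mu ->
     ((exists y : cyc F r n,
         [/\ Q_point y, fixedQ_T y & isoA (forget y) (alpha F n mu)])
      <-> nested mu)) /\
  (exists f : r.-tuple (seq nat) -> cyc F r n,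
     [/\ (forall mu, rpartition n mu -> nested mu ->
            [/\ Q_point (f mu), fixedQ_T (f mu)
              & isoA (forget (f mu)) (alpha F n mu)]),
         (forall y, Q_point y -> fixedQ_T y ->
            exists2 mu, rpartition n mu /\ nested mu & isoQ y (f mu))
       & (forall mu nu, rpartition n mu -> nested mu ->
            rpartition n nu -> nested nu -> isoQ (f mu) (f nu) -> mu = nu)]) /\
  (* (iii) *)
  (forall y : cyc F r n, Q_point y -> fixedQ_T y -> Q0_point y) /\
  (exists f : r.-tuple (seq nat) -> cyc F r n,
     [/\ (forall mu, rpartition n mu -> nested mu ->
            Q0_point (f mu) /\ fixedQ_T (f mu)),
         (forall y, Q0_point y -> fixedQ_T y ->
            exists2 mu, rpartition n mu /\ nested mu & isoQ y (f mu))
       & (forall mu nu, rpartition n mu -> nested mu ->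
            rpartition n nu -> nested nu -> isoQ (f mu) (f nu) -> mu = nu)]).
Proof.
split.
  move=> x x_point; split=> [x_fixed|x_fixed t1 t2 t3 t1_nz t2_nz t3_nz].
    have [_ [mu mu_rpart al_x]] := fixedA_T_classification charF0 x_point x_fixed.
    exact (fixedA_Tr2_iso (isoA_sym al_x) (alpha_fixed mu_rpart)).
  by apply: x_fixed => // a; rewrite /Tu invr_eq0 expf_neq0.
split.
  move=> mu mu_rpart; split=> [[y [y_point _ /isoA_sym al_y]]|mu_nested].
    exact: nested_of_forget mu_rpart y_point al_y.
  by exists (alpha_cyc F n mu); apply: alpha_cyc_fixed_point.
split.
  exists (alpha_cyc F n); split=> [mu|y|mu nu mu_rpart _ nu_rpart _].
  - exact: alpha_cyc_fixed_point.
  - exact: isoQ_alpha_cyc.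
  - exact: alpha_cyc_inj.
split; first by move=> y y_point y_fixed; split; last exact: fixedQ_J_eq0.
exists (alpha_cyc F n).
split=> [mu mu_rpart mu_nested|y [y_point _]|mu nu mu_rpart _ nu_rpart _].
- by have [] := alpha_cyc_fixed_point F mu_rpart mu_nested.
- exact: isoQ_alpha_cyc.
- exact: alpha_cyc_inj.
Qed.
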